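(* For every integer $n\ge 3$, $$c_2(n,K_5^-)=\left\lfloor\frac{2n-2}{3}\right\rfloor.$$
   Context: A $3$-graph $H=(V,E)$ consists of a finite vertex set $V$ and an edge set $E\subseteq\binom{V}{3}$. For distinct $a,b\in V$, the codegree $d_H(a,b)$ is the number of vertices $c$ with $\{a,b,c\}\in E$, and the minimum codegree $\delta_2(H)$ is the minimum of $d_H(a,b)$ over all pairs of distinct vertices. For $3$-graphs $F$ and $H$, an $F$-covering of $H$ is a collection of copies of $F$ in $H$ such that every vertex of $H$ lies in at least one of them. Define $c_2(n,F)$ as the maximum of $\delta_2(H)$ over all $3$-graphs $H$ on $n$ vertices having no $F$-covering. $K_5^-$ denotes the complete $3$-graph on $5$ vertices with one edge removed. *)

(* Defs.v *)
From HB Require Import structures.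
From mathcomp Require Import all_boot.
Set Implicit Arguments.
Unset Strict Implicit.
Unset Printing Implicit Defensive.

Record three_graph (V : finType) := ThreeGraph {
  edges : {set {set V}};
  edges_card3 : [forall e in edges, #|e| == 3]
}.

HB.instance Definition _ (V : finType) := [isSub for @edges V].
HB.instance Definition _ (V : finType) := [Finite of three_graph V by <:].

(* If c is a or b, then [set a; b; c] has at most two elements and is not an
   edge, so c need not be required to differ from a and b. *)
Definition codegree (V : finType) (H : three_graph V) (a b : V) : nat :=
  #|[set c | [set a; b; c] \in edges H]|.

(* Codegrees are at most #|V|, so the default value #|V| of the iterated
   minimum has no effect as soon as V has two distinct elements. *)
Definition min_codegree (V : finType) (H : three_graph V) : nat :=
  \big[minn/#|V|]_(p : V * V | p.1 != p.2) codegree H p.1 p.2.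

(* A copy of F in H is a (not necessarily induced) subgraph of H isomorphic to
   F, encoded as the pair of its vertex set and its edge set. *)
Definition is_copy (U V : finType) (F : three_graph U) (H : three_graph V)
    (K : {set V} * {set {set V}}) : bool :=
  (K.2 \subset edges H) &&
  [exists f : {ffun U -> V},
    [&& injectiveb f,
        K.1 == f @: [set: U] &
        K.2 == [set f @: (e : {set U}) | e in edges F]]].

Definition has_covering (U V : finType) (F : three_graph U)
    (H : three_graph V) : bool :=
  [exists C : {set {set V} * {set {set V}}},
    [forall K in C, is_copy F H K] &&
    [forall x : V, [exists K in C, x \in K.1]]].

(* 3-graphs on n vertices are taken on the vertex set 'I_n, which represents
   every isomorphism class. If n > 0 and F has an edge, the family is nonempty
   (the edgeless 3-graph has no F-covering), so the default value 0 of \max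
   plays no role. *)
Definition c2 (n : nat) (U : finType) (F : three_graph U) : nat :=
  \max_(H : three_graph 'I_n | ~~ has_covering F H) min_codegree H.

Definition K5minus_edges : {set {set 'I_5}} :=
  [set e : {set 'I_5} | #|e| == 3] :\ [set i : 'I_5 | i < 3].

Fact K5minus_edges_card3 : [forall e in K5minus_edges, #|e| == 3].
Proof. by apply/forall_inP => e; rewrite !inE => /andP[]. Qed.

Definition K5minus : three_graph 'I_5 := ThreeGraph K5minus_edges_card3.

(* Main.v *)
Require Import Defs.
From mathcomp Require Import all_boot zify.
Set Implicit Arguments.
Unset Strict Implicit.
Unset Printing Implicit Defensive.

(** Upper bound.  If the minimum codegree d satisfies 3 d >= 2 n - 1, then any
    vertex x lies in an edge.  Summing codegrees over the 3 pairs of this edge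
    gives a vertex joined to all of them, hence a complete 4-set; summing over
    the 6 pairs of the 4-set gives a vertex joined to at least 5 of them, hence
    a copy of K5^- through x.

    Lower bound.  Single out a vertex x and split the other n - 1 vertices into
    three parts as equal as possible, labelling each part by residues mod
    q = ceil((n - 1) / 3).  The link of x is complete tripartite, and among the
    triples avoiding x one discards the transversal ones whose label sum is
    nonzero mod q.  A copy of K5^- through x would contain two transversal
    triples acd and bcd with a, b in the same part, whose labels must then
    agree. *)

(** * Minimum codegree, coverings and copies of [K5minus] *)

Lemma min_codegree_le (V : finType) (H : three_graph V) (a b : V) :
  a != b -> min_codegree H <= codegree H a b.
Proof.
move=> nab; rewrite /min_codegree.
have : (a, b) \in index_enum (V * V)%type by rewrite mem_index_enum.
elim: (index_enum _) => // p s IHs; rewrite inE big_cons.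
case/orP=> [/eqP <- /=|/IHs le_s]; first by rewrite nab geq_min leqnn.
by case: ifP => // _; rewrite geq_min le_s orbT.
Qed.

Lemma leq_min_codegree (V : finType) (H : three_graph V) (k : nat) :
  k <= #|V| -> (forall a b, a != b -> k <= codegree H a b) ->
  k <= min_codegree H.
Proof.
move=> kV kH; rewrite /min_codegree; elim/big_ind: _ => //.
  by move=> u v ku kv; rewrite leq_min ku kv.
by move=> [a b] /= /kH.
Qed.

Lemma edge_card (V : finType) (H : three_graph V) (e : {set V}) :
  e \in edges H -> #|e| = 3.
Proof. by have /forall_inP H3 := edges_card3 H; move=> /H3/eqP. Qed.

Lemma edge_pair_notin (V : finType) (H : three_graph V) (c : V) (p : {set V}) :
  #|p| = 2 -> c |: p \in edges H -> c \notin p.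
Proof. by move=> p2 /edge_card; rewrite cardsU1 p2; case: (c \in p). Qed.

Lemma has_coveringP (U V : finType) (F : three_graph U) (H : three_graph V) :
  reflect (forall x, exists2 K, is_copy F H K & x \in K.1) (has_covering F H).
Proof.
apply: (iffP existsP) => [[C /andP[/forall_inP CH /forallP Cx]] x|cov].
  by have /exists_inP[K KC xK] := Cx x; exists K; first exact: CH.
(* The collection of all copies covers whatever any collection of copies does. *)
exists [set K | is_copy F H K]; apply/andP; split.
  by apply/forall_inP=> K; rewrite inE.
apply/forallP=> x; have [K KH xK] := cov x.
by apply/exists_inP; exists K; rewrite ?inE.
Qed.

(** Enumerating [W] with [M] first sends the missing triple {0, 1, 2} of [K5minus] onto [M]. Copies
    need not be induced, so [M] itself may or may not be an edge. *)
Lemma K5minus_copy (V : finType) (H : three_graph V) (W M : {set V}) :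
  #|W| = 5 -> #|M| = 3 -> M \subset W ->
  (forall e : {set V}, e \subset W -> #|e| = 3 -> e != M -> e \in edges H) ->
  exists2 K, is_copy K5minus H K & K.1 = W.
Proof.
move=> W5 M3 MW WH; pose s := enum M ++ enum (W :\: M).
have sW : s =i W.
  move=> v; rewrite mem_cat !mem_enum inE.
  by case: (boolP (v \in M)) => //= /(subsetP MW).
have us : uniq s.
  rewrite cat_uniq !enum_uniq /= andbT; apply/hasPn=> v.
  by rewrite !mem_enum inE => /andP[].
have s5 : size s = 5 by rewrite -(card_uniqP us) (eq_card sW).
have [x0 _] : exists x, x \in M by apply/card_gt0P; rewrite M3.
pose f := [ffun i : 'I_5 => nth x0 s i].
have f_inj : injective f.
  move=> i j; rewrite !ffunE => /eqP.
  by rewrite nth_uniq ?s5 // => /eqP/val_inj.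
have fT : f @: [set: 'I_5] = W.
  apply/eqP; rewrite eqEcard card_imset // cardsT card_ord W5 leqnn andbT.
  by apply/subsetP=> _ /imsetP[i _ ->]; rewrite ffunE -sW mem_nth ?s5.
have c3 : #|[set i : 'I_5 | i < 3]| = 3.
  by rewrite cardE /enum_mem -enumT !enum_ordSl enum_ord0 /= !inE.
have fM : f @: [set i : 'I_5 | i < 3] = M.
  apply/eqP; rewrite eqEcard card_imset // M3 c3 leqnn andbT.
  apply/subsetP=> _ /imsetP[i + ->]; rewrite inE ffunE => i3.
  by rewrite nth_cat -cardE M3 i3 -mem_enum mem_nth // -cardE M3.
exists (f @: [set: 'I_5], [set f @: (e : {set _}) | e in edges K5minus]) => //.
apply/andP; split=> /=; last first.
  by apply/existsP; exists f; rewrite !eqxx !andbT; apply/injectiveP.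
apply/subsetP=> _ /imsetP[e + ->]; rewrite !inE => /andP[e012 /eqP e3].
apply: WH; first by rewrite -fT imsetS ?subsetT.
  by rewrite card_imset.
by rewrite -fM (inj_eq (imset_inj f_inj)).
Qed.

(** * Upper bound by double counting *)

Definition pairs (V : finType) (S : {set V}) : {set {set V}} :=
  [set p : {set V} | p \subset S & #|p| == 2].

(** This is the link graph of [c] restricted to [S]. *)
Definition joined_pairs {V : finType} (H : three_graph V) (S : {set V}) (c : V)
  : {set {set V}} := [set p in pairs S | c |: p \in edges H].

(** Count the couples of a pair [p] in [S] and a vertex [c] forming an edge with [p]. A vertex [c]
    of [S] is joined only to pairs avoiding [c], which gives the binomial on the left. If every
    vertex outside [S] were joined to at most [k] pairs, the total would fall short of the sum of
    codegrees. *)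
Lemma ex_joined_pairs_gt (V : finType) (H : three_graph V) (S : {set V})
    (k : nat) :
  #|S| * 'C(#|S|.-1, 2) + (#|V| - #|S|) * k < 'C(#|S|, 2) * min_codegree H ->
  exists2 c, c \notin S & k < #|joined_pairs H S c|.
Proof.
move=> lt_k; apply/exists_inP; apply: contraLR lt_k.
rewrite negb_exists_in -leqNgt => /forall_inP le_k.
have pairs_deg :
  'C(#|S|, 2) * min_codegree H <=
    \sum_(p in pairs S) \sum_(c | c |: p \in edges H) 1.
  rewrite -cards_draws -sum_nat_const; apply: leq_sum => p.
  rewrite inE => /andP[_ /cards2P[a [b [nab ->]]]].
  rewrite sum1_card; apply: leq_trans (min_codegree_le H nab) _.
  rewrite /codegree cardsE; apply: eq_leq.
  by apply: eq_card => c; rewrite unfold_in /= setUC.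
apply: (leq_trans pairs_deg).
rewrite (exchange_big_dep predT) //= (bigID [in S]) /= leq_add //.
  rewrite -sum_nat_const; apply: leq_sum => c cS.
  have -> : #|S|.-1 = #|S :\ c| by rewrite (cardsD1 c S) cS.
  rewrite sum1_card -cards_draws subset_leq_card //; apply/subsetP=> p.
  rewrite unfold_in /= !inE => /andP[/andP[pS /eqP p2] pc].
  by rewrite subsetD1 pS (edge_pair_notin p2 pc) p2.
have -> : #|V| - #|S| = #|~: S| by rewrite [RHS]cardsCs setCK.
rewrite -sum_nat_const.
rewrite [leqRHS](eq_bigl (fun c => c \notin S)); last by move=> c; rewrite inE.
apply: leq_sum => c cS; rewrite sum1_card.
have := le_k c cS; rewrite -leqNgt; apply: leq_trans.
by apply: eq_leq; apply: eq_card => p; rewrite [in RHS]inE.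
Qed.

Lemma min_codegree_covering (V : finType) (H : three_graph V) :
  3 <= #|V| -> 2 * #|V| - 2 < 3 * min_codegree H -> has_covering K5minus H.
Proof.
move=> V3 dH; apply/has_coveringP=> x.
have [a ax] : exists a, a \in [set~ x].
  by apply/card_gt0P; rewrite cardsC1; lia.
have S2 : #|[set x; a]| = 2.
  by move: ax; rewrite !inE eq_sym => nxa; rewrite cards2 nxa.
have [|b bS jb] := @ex_joined_pairs_gt V H [set x; a] 0.
  by rewrite S2 binn bin_small //; lia.
pose T := b |: [set x; a].
have T3 : #|T| = 3 by rewrite cardsU1 bS S2.
have TH : T \in edges H.
  have /card_gt0P[p] := jb; rewrite !inE => /andP[/andP[pS p2] pH].
  rewrite /T; suff <- : p = [set x; a] by [].
  by apply/eqP; rewrite eqEcard pS S2 (eqP p2).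
(* Here the count requires 3 + 2 (n - 3) < 3 d, with n = [#|V|] and d the minimum codegree. More
   than 2 of the 3 pairs means all of them. *)
have [|c cT jc] := @ex_joined_pairs_gt V H T 2.
  by rewrite T3 (_ : 'C(3, 2) = 3) // binn; lia.
have jT : joined_pairs H T c = pairs T.
  apply/eqP; rewrite eqEcard cards_draws T3 jc andbT.
  by apply/subsetP=> p; rewrite inE => /andP[].
pose S := c |: T.
have S4 : #|S| = 4 by rewrite cardsU1 cT T3.
have SH (e : {set V}) : e \subset S -> #|e| = 3 -> e \in edges H.
  move=> eS e3; have [ce|ce] := boolP (c \in e).
    rewrite -(setD1K ce).
    suff: e :\ c \in joined_pairs H T c by rewrite inE => /andP[].
    by rewrite jT inE subDset eS; have := cardsD1 c e; rewrite ce e3; lia.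
  suff -> : e = T by [].
  by apply/eqP; rewrite eqEcard T3 e3 andbT -(setU1K cT) subsetD1 ce andbT.
have V4 : 4 <= #|V| by rewrite -S4 max_card.
(* The count now requires 12 + 4 (n - 4) < 6 d, which is exactly the hypothesis doubled. [V4] keeps
   the truncated subtraction exact. *)
have [|d dS jd] := @ex_joined_pairs_gt V H S 4.
  by rewrite S4 (_ : 'C(4, 2) = 6) // (_ : 'C(4.-1, 2) = 3) //; lia.
have pS6 : #|pairs S| = 6 by rewrite cards_draws S4.
(* At least 5 of the 6 pairs are joined to [d]: [p0] is the exceptional pair, or an arbitrary one if
   there is none. The missing triple of the copy is then [d |: p0]. *)
have [p0 p0S p0P] : exists2 p0, p0 \in pairs S &
    forall p, p \in pairs S -> p != p0 -> d |: p \in edges H.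
  have jS : joined_pairs H S d \subset pairs S.
    by apply/subsetP=> p; rewrite inE => /andP[].
  have [allS|] := boolP (pairs S \subset joined_pairs H S d).
    have /card_gt0P[p0 p0S] : 0 < #|pairs S| by rewrite pS6.
    by exists p0 => // p /(subsetP allS); rewrite inE => /andP[].
  case/subsetPn=> p0 p0S p0J; exists p0 => // p pS np.
  have jE : joined_pairs H S d = pairs S :\ p0.
    apply/eqP; rewrite eqEcard subsetD1 jS p0J /=.
    by have := cardsD1 p0 (pairs S); rewrite p0S pS6 add1n => -[<-].
  suff : p \in joined_pairs H S d by rewrite inE => /andP[].
  by rewrite jE !inE np; rewrite inE in pS.
have /andP[p0S' /eqP p02] : (p0 \subset S) && (#|p0| == 2).
  by rewrite inE in p0S.
have [|||e eW e3 eM|K KH KW] := @K5minus_copy V H (d |: S) (d |: p0).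
- by rewrite cardsU1 dS S4.
- by rewrite cardsU1 p02 (contra (subsetP p0S' d) dS).
- exact: setUS.
- have [de|de] := boolP (d \in e); last first.
    by apply: SH => //; rewrite -(setU1K dS) subsetD1 eW de.
  rewrite -(setD1K de); apply: p0P.
    by rewrite inE subDset eW; have := cardsD1 d e; rewrite de e3; lia.
  by apply: contraNneq eM => <-; rewrite setD1K.
by exists K => //; rewrite KW !inE eqxx !orbT.
Qed.

(** * Lower bound: the construction and its codegrees *)

Section Construction.
Variable m : nat.

(* q = ceil(m / 3), where m is the number of vertices other than [ord_max]. *)
Let q := (m + 2) %/ 3.
(** Remainder and quotient by 3 determine the vertex, so labels are distinct within a part, and the
    parts of 0, ..., m - 1 are balanced. *)
Let part (v : 'I_m.+1) : 'I_3 := inord (v %% 3).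
Let label (v : 'I_m.+1) : nat := v %/ 3.

Definition construction_edges : {set {set 'I_m.+1}} :=
  [set e : {set 'I_m.+1} | (#|e| == 3) &&
     if ord_max \in e then #|part @: (e :\ ord_max)| == 2
     else (#|part @: e| == 3) ==> (q %| \sum_(v in e) label v)].

Fact construction_edges_card3 : [forall e in construction_edges, #|e| == 3].
Proof. by apply/forall_inP=> e; rewrite inE => /andP[]. Qed.

Definition construction : three_graph 'I_m.+1 :=
  ThreeGraph construction_edges_card3.

Lemma link_edge (a b : 'I_m.+1) : a != b -> a != ord_max -> b != ord_max ->
  ([set ord_max; a; b] \in edges construction) = (part a != part b).
Proof.
move=> nab na nb.
have nS : ord_max \notin [set a; b].
  by rewrite !inE ![ord_max == _]eq_sym !negb_or na.
rewrite inE -setUA cardsU1 nS cards2 nab setU11 setU1K // imsetU1 imset_set1.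
by rewrite cards2; case: (_ != _).
Qed.

Lemma nonlink_edge (a b c : 'I_m.+1) :
  a != b -> a != c -> b != c ->
  a != ord_max -> b != ord_max -> c != ord_max ->
  ([set a; b; c] \in edges construction) =
    ([&& part a != part b, part a != part c & part b != part c] ==>
       (q %| label a + label b + label c)).
Proof.
move=> nab nac nbc na nb nc.
have aS : a \notin [set b; c] by rewrite !inE negb_or nab.
have S3 : #|[set a; b; c]| = 3 by rewrite -setUA cardsU1 aS cards2 nbc.
rewrite inE S3 eqxx /= !inE ![ord_max == _]eq_sym.
rewrite (negPf na) (negPf nb) (negPf nc) /=.
rewrite -setUA imsetU1 imsetU1 imset_set1 cardsU1 cards2 !inE.
rewrite big_setU1 //= big_setU1 ?inE //= big_set1 addnA.
by case: (part a == part b); case: (part a == part c); case: (part b == part c).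
Qed.

Lemma label_inj (a b : 'I_m.+1) : part a = part b -> label a = label b -> a = b.
Proof.
move=> pab lab; apply: val_inj; rewrite /= (divn_eq a 3) (divn_eq b 3).
rewrite -/(label a) -/(label b) lab; congr (_ + _).
by have := congr1 val pab; rewrite /part /= !inordK ?ltn_pmod.
Qed.

Lemma label_lt (a : 'I_m.+1) : a != ord_max -> label a < q.
Proof.
move=> na; have : a < m.
  by rewrite ltn_neqAle -ltnS ltn_ord andbT.
by rewrite /label /q; lia.
Qed.

(** Within one part the labels are injective with values below [q], and here they miss [r]. *)
Lemma card_same_part (N : {set 'I_m.+1}) (i : 'I_3) (r : nat) :
  r < q ->
  (forall c, c \in N -> [/\ c != ord_max, part c = i & label c != r]) ->
  #|N| < q.
Proof.
move=> rq NP; pose g (c : 'I_m.+1) : 'I_q := insubd (Ordinal rq) (label c).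
have gE c : c \in N -> g c = label c :> nat.
  by case/NP=> nc _ _; rewrite val_insubd label_lt.
have g_inj : {in N &, injective g}.
  move=> c d cN dN gcd; apply: label_inj.
    by case/NP: cN => _ -> _; case/NP: dN.
  by rewrite -!gE // gcd.
rewrite -(card_in_imset g_inj) -[ltnRHS]card_ord -cardsT; apply: proper_card.
apply/properP; split; first exact: subsetT.
exists (Ordinal rq); rewrite ?inE //; apply/imsetP=> -[c cN /(congr1 val)] /=.
by case/NP: (cN) => _ _; rewrite gE // eq_sym => /eqP.
Qed.

Definition nonneighbours (a b : 'I_m.+1) : {set 'I_m.+1} :=
  [set c | [&& c != a, c != b & [set a; b; c] \notin edges construction]].

Lemma codegree_nonneighbours (a b : 'I_m.+1) : a != b ->
  codegree construction a b + #|nonneighbours a b| = m.-1.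
Proof.
move=> nab; rewrite /codegree /nonneighbours.
have := cardsC [set a; b]; rewrite cards2 nab card_ord => cC.
have {cC} -> : m.-1 = #|~: [set a; b]| by lia.
rewrite -(cardsID [set c | [set a; b; c] \in edges construction] (~: _)).
have E3 e : e \in edges construction -> #|e| == 3 by move/edge_card/eqP.
move: (edges construction) E3 => E E3; congr (_ + _); apply: eq_card => c.
  rewrite !(in_set, in_set1) negb_or.
  have [->|nca] := eqVneq c a.
    by apply/negbTE/negP => /E3; rewrite setUC setUA setUid cards2 nab.
  have [->|//] := eqVneq c b.
  by apply/negbTE/negP => /E3; rewrite -setUA setUid cards2 nab.
by rewrite !(in_set, in_set1) negb_or andbA andbC.
Qed.

Lemma nonneighboursC (a b : 'I_m.+1) : nonneighbours a b = nonneighbours b a.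
Proof.
rewrite /nonneighbours (setUC [set a]); apply/setP=> c.
by rewrite in_set [RHS]in_set andbCA.
Qed.

(** If [a] is [ord_max], nonneighbours lie in the part of [b] and differ from [b]. If [a] and [b]
    share a part, only [ord_max] can be one. Otherwise they lie in the third part and avoid the
    label that makes the sum divisible by [q]. *)
Lemma card_nonneighbours_lt (a b : 'I_m.+1) : a != b ->
  #|nonneighbours a b| < q.
Proof.
wlog nb : a b / b != ord_max.
  move=> H nab; have [bE|nb] := eqVneq b ord_max; last exact: H.
  by rewrite nonneighboursC; apply: H; rewrite -?bE // eq_sym.
move=> nab; have [aE|na] := eqVneq a ord_max.
  apply: (@card_same_part _ (part b) (label b)) => [|c]; first exact: label_lt.
  rewrite inE aE eq_sym [c == b]eq_sym => /and3P[nc nbc].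
  rewrite link_edge 1?[c == _]eq_sym // negbK => /eqP pbc.
  split=> //; rewrite eq_sym.
  by apply: contraNneq nbc => /(label_inj pbc)->.
have [pab|npab] := eqVneq (part a) (part b).
  have q2 : 1 < q.
    have nl : label a != label b.
      by apply: contraNneq nab => /(label_inj pab) ->.
    by have := label_lt na; have := label_lt nb; move: nl; lia.
  apply: leq_ltn_trans q2; rewrite -(cards1 (ord_max : 'I_m.+1)).
  apply/subset_leq_card/subsetP=> c; rewrite inE eq_sym [c == b]eq_sym.
  case/and3P=> nac nbc; rewrite in_set1; apply: contraR => nc.
  by rewrite nonlink_edge // pab eqxx.
have q0 : 0 < q by have := label_lt na; lia.
(* The residue of minus the label sum; the outer reduction keeps it below [q] when that sum is 0 mod
   [q]. *)
pose r := (q - (label a + label b) %% q) %% q.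
have rP : q %| label a + label b + r.
  rewrite /dvdn modnDmr -modnDml subnKC ?modnn //.
  by rewrite ltnW ?ltn_pmod.
pose i := odflt ord0 [pick i | (i != part a) && (i != part b)].
apply: (@card_same_part _ i r) => [|c]; first by rewrite ltn_pmod.
rewrite inE eq_sym [c == b]eq_sym => /and3P[nac nbc].
have [->|nc] := eqVneq c ord_max.
  by rewrite setUC setUA link_edge ?npab.
rewrite nonlink_edge // negb_imply => /andP[/and3P[_ pac pbc] nq].
split=> //; last by apply: contraNneq nq => ->.
rewrite /i; case: pickP => [j /andP[nja njb]|/(_ (part c))] /=.
  apply/val_inj; move: npab pac pbc nja njb; rewrite -!val_eqE /=.
  move: (ltn_ord (part a)) (ltn_ord (part b)) (ltn_ord (part c)) (ltn_ord j).
  by lia.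
by rewrite !(eq_sym (part c)) pac pbc.
Qed.

Lemma construction_min_codegree :
  2 <= m -> (2 * m) %/ 3 <= min_codegree construction.
Proof.
move=> m2; apply: leq_min_codegree => [|a b nab].
  by rewrite card_ord; lia.
(* The codegree is at least (m - 1) - (q - 1) = m - ceil(m / 3) = floor(2 m / 3). *)
have := codegree_nonneighbours nab; have := card_nonneighbours_lt nab.
by rewrite /q; lia.
Qed.

(** The hypotheses list the seven triples that do not contain both [a] and [b]. Those through
    [ord_max] put [c] and [d] in different parts and force [a] and [b] into the third; the other two
    make their labels congruent mod [q], hence equal. *)
Lemma construction_no_K5minus (a b c d : 'I_m.+1) :
  uniq [:: ord_max; a; b; c; d] ->
  [set ord_max; a; c] \in edges construction ->
  [set ord_max; a; d] \in edges construction ->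
  [set ord_max; b; c] \in edges construction ->
  [set ord_max; b; d] \in edges construction ->
  [set ord_max; c; d] \in edges construction ->
  [set a; c; d] \in edges construction ->
  [set b; c; d] \in edges construction -> False.
Proof.
move=> u Eac Ead Ebc Ebd Ecd Eacd Ebcd.
move: u; rewrite /= !inE !negb_or ![ord_max == _]eq_sym.
case/and5P=> /and4P[na nb nc nd] /and3P[nab nac nad] /andP[nbc nbd] ncd _.
move: Eac Ead Ebc Ebd Ecd; rewrite !link_edge // => pac pad pbc pbd pcd.
move: Eacd Ebcd; rewrite !nonlink_edge // pac pad pbc pbd pcd /= => qa qb.
case/eqP: nab; apply: label_inj.
  apply/val_inj; move: pac pad pbc pbd pcd; rewrite -!val_eqE /=.
  move: (ltn_ord (part a)) (ltn_ord (part b)).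
  move: (ltn_ord (part c)) (ltn_ord (part d)).
  by lia.
have : label a = label b %[mod q].
  apply/eqP; rewrite -(eqn_modDr (label c + label d)) !addnA.
  by rewrite (eqP qa) (eqP qb).
by rewrite !modn_small ?label_lt.
Qed.

Lemma construction_no_covering : ~~ has_covering K5minus construction.
Proof.
apply/has_coveringP=> /(_ ord_max)[[W E]] /andP[/= EH /existsP[f]].
case/and3P=> /injectiveP f_inj /eqP-> /eqP EE /imsetP[i _ fi].
pose o k : 'I_5 := inord k.
(* Three distinct indices form a triple other than {0, 1, 2} as soon as one of them is at least
   3. *)
have fE (j k l : nat) : j < 5 -> k < 5 -> l < 5 -> uniq [:: j; k; l] ->
    has (leq 3) [:: j; k; l] ->
    [set f (o j); f (o k); f (o l)] \in edges construction.
  move=> j5 k5 l5 u g3; apply: (subsetP EH); rewrite EE.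
  apply/imsetP; exists [set o j; o k; o l]; last by rewrite !imsetU !imset_set1.
  have o_eq s t : s < 5 -> t < 5 -> (o s == o t) = (s == t).
    by move=> s5 t5; rewrite -val_eqE /= !inordK.
  move: u; rewrite /= !inE negb_or andbT => /andP[/andP[ujk ujl] ukl].
  rewrite -setUA cardsU1 cards2 !inE !o_eq // (negPf ujk) (negPf ujl) ukl andbT.
  apply/eqP=> /setP eS; case/hasP: g3 => t tS t3.
  have t5 : t < 5 by move: tS; rewrite !inE => /or3P[] /eqP->.
  have := eS (o t); rewrite !inE !o_eq // inordK // ltnNge t3.
  by move: tS; rewrite !inE => ->.
have fu s : uniq s -> all (ltn^~ 5) s -> uniq (map (f \o o) s).
  move=> us /allP s5; rewrite map_inj_in_uniq // => j k /s5 j5 /s5 k5.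
  by move=> /f_inj /(congr1 val); rewrite /= !inordK.
have {fi}iE : f (o i) = ord_max by rewrite /o inord_val.
(* No listed triple contains both a and b, so choosing a and b in the missing
   triple {0, 1, 2} makes all of them edges of K5^-. *)
have key (j a b c d : nat) : f (o j) = ord_max ->
    uniq [:: j; a; b; c; d] -> all (ltn^~ 5) [:: j; a; b; c; d] ->
    all (fun t : nat * nat * nat => has (leq 3) [:: t.1.1; t.1.2; t.2])
      [:: (j, a, c); (j, a, d); (j, b, c); (j, b, d); (j, c, d);
          (a, c, d); (b, c, d)] -> False.
  move=> fj u5 a5 g3; have := fu _ u5 a5; rewrite /= fj => uf.
  move: u5 a5 g3; rewrite /= !inE !negb_or !andbT.
  case/and4P=> /and4P[nja njb njc njd] /and3P[nab nac nad] /andP[nbc nbd] ncd.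
  case/and5P=> j5 a5 b5 c5 d5 /and5P[g1 g2 g3 g4 /and3P[g5 g6 g7]].
  by apply: (construction_no_K5minus uf); rewrite -?fj;
    apply: fE => //=; rewrite ?inE ?negb_or ?nja ?njb ?njc ?njd ?nab ?nac ?nad
      ?nbc ?nbd ?ncd //= orbF.
case: i iE => -[|[|[|[|[|//]]]]] /= _ iE.
- exact: (key 0 1 2 3 4).
- exact: (key 1 0 2 3 4).
- exact: (key 2 0 1 3 4).
- exact: (key 3 1 2 4 0).
- exact: (key 4 1 2 3 0).
Qed.

End Construction.

Theorem theorem4 (n : nat) (hn : 3 <= n) :
  c2 n K5minus = (2 * n - 2) %/ 3.
Proof.
apply/eqP; rewrite eqn_leq; apply/andP; split.
  apply/bigmax_leqP=> H; apply: contraR; rewrite -ltnNge => ltH.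
  by apply: min_codegree_covering; rewrite card_ord //; lia.
case: n hn => // m hm.
have -> : (2 * m.+1 - 2) %/ 3 = (2 * m) %/ 3 by lia.
apply: leq_trans (construction_min_codegree _) _; first by [].
exact: (bigmax_sup (construction m) (construction_no_covering m)).
Qed.
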